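(* Let $K$ be an algebraically closed field of characteristic zero, let $n\ge1$, let $f=f_1x_1+\cdots+f_nx_n$ and $g=g_1x_1+\cdots+g_nx_n$ with $f_i,g_i\in\mathbb N$ be elements of the free commutative binoid $F$ on $x_1,\ldots,x_n$, and let $M=F/(f=g)$ be the quotient of $F$ by the congruence generated by $f\sim g$, so that $K[M]=K[X_1,\ldots,X_n]/(X^f-X^g)$, where $X^{h}:=X_1^{h_1}\cdots X_n^{h_n}$. (1) If $g=0$, then $K\text{-}\mathrm{spec}\,M$ is connected if and only if $M$ is torsion-free. In this case there are $r,s\ge0$ such that $K\text{-}\mathrm{spec}\,M=\mathbb A^r(K)\times(K\setminus\{0\})^s$. (2) If $g\neq0$ and $f=\tilde f+g$ for some $\tilde f=\tilde f_1x_1+\cdots+\tilde f_nx_n$ (with $\tilde f_i\in\mathbb N$), then $K\text{-}\mathrm{spec}\,M$ is disconnected if $\operatorname{supp} g\subseteq\operatorname{supp}\tilde f$, and connected otherwise. (3) If $f=\tilde f+h$ and $g=\tilde g+h$ (with $\tilde f,\tilde g,h$ all $\mathbb N$-linear combinations of $x_1,\ldots,x_n$) such that $\operatorname{supp}\tilde f\neq\emptyset$, $\operatorname{supp}\tilde g\ne\emptyset$ and $\operatorname{supp}\tilde f\cap\operatorname{supp}\tilde g=\emptyset$, then $K\text{-}\mathrm{spec}\,M$ is connected.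
   Context: A commutative binoid (written additively) is a commutative monoid $(M,+,0)$ with an absorbing element $\infty$; homomorphisms are monoid homomorphisms with $\infty\mapsto\infty$. The free commutative binoid on $x_1,\ldots,x_n$ is $\mathbb N^n\cup\{\infty\}$ with an adjoined absorbing element, where $x_i$ is the $i$-th standard basis vector. For $h=\sum h_ix_i$, $\operatorname{supp}h=\{i\mid h_i\neq0\}$. $M$ is torsion-free if $ma=mb$ with $m\ge1$ implies $a=b$. For a field $K$, viewed as the binoid $(K,\cdot,1,0)$, $K\text{-}\mathrm{spec}\,M$ is the set of binoid homomorphisms $M\to K$. Via $\varphi\mapsto(\varphi(x_1),\ldots,\varphi(x_n))$ it is identified with the zero set of $X^f-X^g$ in $\mathbb A^n(K)=K^n$ and carries the subspace topology of the Zariski topology. A nonempty space is connected if it is not the union of two disjoint nonempty open sets, otherwise disconnected. $\mathbb A^r(K)\times(K\setminus\{0\})^s$ carries the Zariski topology. *)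

(* Defs.v *)
From HB Require Import structures.
(* mpoly comes first: it shadows names such as [symmetric]. *)
From mathcomp.multinomials Require Import mpoly.
From mathcomp Require Import all_boot all_order all_algebra.
From mathcomp Require Import all_classical topology.

Set Implicit Arguments.
Unset Strict Implicit.
Unset Printing Implicit Defensive.

Import GRing.Theory.
Local Open Scope classical_set_scope.
Local Open Scope ring_scope.
Local Open Scope quotient_scope.

(** * Commutative binoids, written additively *)

HB.mixin Record isBinoid M of GRing.Nmodule M := {
  binfty : M;
  add_binfty : forall x : M, binfty + x = binfty
}.

#[short(type="binoidType")]
HB.structure Definition Binoid := { M of GRing.Nmodule M & isBinoid M }.

Definition torsion_free (M : binoidType) : Prop :=
  forall (m : nat) (a b : M), (1 <= m)%N -> a *+ m = b *+ m -> a = b.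

(* [Some h] is the linear combination [\sum_i h i * x_i], [None] is infinity. *)
Definition free_binoid (n : nat) : Type := option {ffun 'I_n -> nat}.

HB.instance Definition _ (n : nat) := Choice.on (free_binoid n).

Definition free_add n (a b : free_binoid n) : free_binoid n :=
  if a is Some u then if b is Some v then Some (u + v) else None else None.

Lemma free_addA n : associative (@free_add n).
Proof. by case=> [a|] [b|] [c|] //=; rewrite addrA. Qed.

Lemma free_addC n : commutative (@free_add n).
Proof. by case=> [a|] [b|] //=; rewrite addrC. Qed.

Lemma free_add0 n : left_id (Some 0 : free_binoid n) (@free_add n).
Proof. by case=> [a|] //=; rewrite add0r. Qed.

HB.instance Definition _ (n : nat) := GRing.isNmodule.Build (free_binoid n)
  (@free_addA n) (@free_addC n) (@free_add0 n).

Lemma free_add_infty n (a : free_binoid n) : (None : free_binoid n) + a = None.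
Proof. by []. Qed.

HB.instance Definition _ (n : nat) :=
  isBinoid.Build (free_binoid n) (@free_add_infty n).

Definition free_of n (h : {ffun 'I_n -> nat}) : free_binoid n := Some h.

Definition free_var n (i : 'I_n) : free_binoid n :=
  free_of [ffun j => (j == i) : nat].

Definition supp n (h : {ffun 'I_n -> nat}) : {set 'I_n} :=
  finset (fun i => h i != 0%N).

(** * Quotient of a binoid by the congruence generated by one relation *)

Inductive gen_cong (M : binoidType) (a b : M) : M -> M -> Prop :=
| gen_cong_rel : gen_cong a b a b
| gen_cong_refl x : gen_cong a b x x
| gen_cong_sym x y : gen_cong a b x y -> gen_cong a b y x
| gen_cong_trans x y z :
    gen_cong a b x y -> gen_cong a b y z -> gen_cong a b x z
| gen_cong_add x y z : gen_cong a b x y -> gen_cong a b (x + z) (y + z).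

Definition gen_congb (M : binoidType) (a b : M) : rel M :=
  fun x y => `[< gen_cong a b x y >].

Lemma gen_congb_refl (M : binoidType) (a b : M) : reflexive (gen_congb a b).
Proof. by move=> x; apply/asboolP; exact: gen_cong_refl. Qed.

Lemma gen_congb_sym (M : binoidType) (a b : M) : symmetric (gen_congb a b).
Proof. by move=> x y; apply/asboolP/asboolP; exact: gen_cong_sym. Qed.

Lemma gen_congb_trans (M : binoidType) (a b : M) : transitive (gen_congb a b).
Proof.
move=> y x z /asboolP xy /asboolP yz.
by apply/asboolP; exact: gen_cong_trans xy yz.
Qed.

Canonical gen_cong_equiv (M : binoidType) (a b : M) :=
  EquivRel (gen_congb a b)
    (gen_congb_refl a b) (gen_congb_sym a b) (@gen_congb_trans M a b).

Definition quot_binoid (M : binoidType) (a b : M) : Type :=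
  {eq_quot gen_congb a b}.

HB.instance Definition _ (M : binoidType) (a b : M) :=
  Choice.on (quot_binoid a b).

HB.instance Definition _ (M : binoidType) (a b : M) :=
  EqQuotient.on (quot_binoid a b).

Definition quot_pi (M : binoidType) (a b : M) (x : M) : quot_binoid a b :=
  \pi_(quot_binoid a b) x.

Lemma quot_piP (M : binoidType) (a b x y : M) :
  quot_pi a b x = quot_pi a b y <-> gen_cong a b x y.
Proof.
rewrite /quot_pi; split.
  by move/eqP; rewrite eqmodE => /asboolP.
by move=> xy; apply/eqP; rewrite eqmodE; apply/asboolP.
Qed.

Definition quot_add (M : binoidType) (a b : M) (u v : quot_binoid a b) :
  quot_binoid a b := quot_pi a b (repr u + repr v).

Lemma quot_add_pi (M : binoidType) (a b x y : M) :
  quot_add (quot_pi a b x) (quot_pi a b y) = quot_pi a b (x + y).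
Proof.
have reprP z : gen_cong a b (repr (quot_pi a b z)) z.
  by apply/quot_piP; rewrite /quot_pi reprK.
apply/quot_piP; apply: (@gen_cong_trans _ _ _ _ (x + repr (quot_pi a b y))).
  exact: gen_cong_add.
by rewrite ![x + _]addrC; exact: gen_cong_add.
Qed.

Lemma quot_ind (M : binoidType) (a b : M) (P : quot_binoid a b -> Prop) :
  (forall x, P (quot_pi a b x)) -> forall u, P u.
Proof. by move=> Ppi u; rewrite -[u]reprK; exact: Ppi. Qed.

Lemma quot_addA (M : binoidType) (a b : M) : associative (@quot_add M a b).
Proof.
elim/quot_ind=> x; elim/quot_ind=> y; elim/quot_ind=> z.
by rewrite !quot_add_pi addrA.
Qed.

Lemma quot_addC (M : binoidType) (a b : M) : commutative (@quot_add M a b).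
Proof.
by elim/quot_ind=> x; elim/quot_ind=> y; rewrite !quot_add_pi addrC.
Qed.

Lemma quot_add0 (M : binoidType) (a b : M) :
  left_id (quot_pi a b 0) (@quot_add M a b).
Proof. by elim/quot_ind=> x; rewrite quot_add_pi add0r. Qed.

HB.instance Definition _ (M : binoidType) (a b : M) :=
  GRing.isNmodule.Build (quot_binoid a b)
    (@quot_addA M a b) (@quot_addC M a b) (@quot_add0 M a b).

Lemma quot_add_infty (M : binoidType) (a b : M) (u : quot_binoid a b) :
  quot_pi a b binfty + u = quot_pi a b binfty.
Proof.
by elim/quot_ind: u => x; rewrite [LHS]quot_add_pi add_binfty.
Qed.

HB.instance Definition _ (M : binoidType) (a b : M) :=
  isBinoid.Build (quot_binoid a b) (@quot_add_infty M a b).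

(** * K-points: binoid homomorphisms to the binoid (K, *, 1, 0) *)

Record kspec (K : fieldType) (M : binoidType) := KPoint {
  kval :> M -> K;
  kval0 : kval 0 = 1;
  kvalD : forall x y, kval (x + y) = kval x * kval y;
  kval_infty : kval binfty = 0
}.

HB.instance Definition _ (K : fieldType) (M : binoidType) :=
  gen_eqMixin (kspec K M).
HB.instance Definition _ (K : fieldType) (M : binoidType) :=
  gen_choiceMixin (kspec K M).

(** * Affine space with the Zariski topology *)

Definition affine (K : fieldType) (n : nat) : Type := 'I_n -> K.

HB.instance Definition _ (K : fieldType) (n : nat) := Choice.on (affine K n).

(* Complement of the common zero set of a set of polynomials. *)
Definition zariski_open (K : fieldType) (n : nat) : set (set (affine K n)) :=
  [set U | exists S : set {mpoly K[n]},
     U = ~` [set x | forall p, S p -> p.@[x] = 0]].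

Lemma zariski_openT (K : fieldType) (n : nat) :
  zariski_open [set: affine K n].
Proof.
exists [set (1 : {mpoly K[n]})].
apply/seteqP; split=> // x _ /= /(_ 1 erefl) /eqP.
by rewrite meval1 oner_eq0.
Qed.

Lemma zariski_openI (K : fieldType) (n : nat) :
  setI_closed (@zariski_open K n).
Proof.
move=> _ _ [S ->] [T ->].
exists [set r | exists p q, [/\ S p, T q & r = p * q]].
rewrite -setCU; congr (~` _); apply/seteqP; split=> x /=.
  move=> STx _ [p [q [Sp Tq ->]]]; rewrite mevalM.
  by case: STx => [/(_ p Sp)|/(_ q Tq)] ->; rewrite ?mul0r ?mulr0.
move=> STx; apply: contrapT => /not_orP[/existsNP[p /not_implyP[Sp px]]].
move=> /existsNP[q /not_implyP[Tq qx]].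
have /eqP : (p * q).@[x] = 0 by apply: STx; exists p, q.
by rewrite mevalM mulf_eq0 => /orP[] /eqP.
Qed.

Lemma zariski_open_bigU (K : fieldType) (n : nat) (I : Type)
    (U : I -> set (affine K n)) :
  (forall i, zariski_open (U i)) -> zariski_open (\bigcup_i U i).
Proof.
move=> /choice[S US]; exists (\bigcup_i S i); apply/seteqP; split=> x /=.
  move=> [i _]; rewrite US /= => Six Sx; apply: Six => p Sp.
  by apply: Sx; exists i.
move=> /existsNP[p /not_implyP[[i _ Sp] px]]; exists i => //.
by rewrite US /= => Six; apply: px; exact: Six.
Qed.

HB.instance Definition _ (K : fieldType) (n : nat) :=
  isOpenTopological.Build (affine K n)
    (@zariski_openT K n) (@zariski_openI K n) (@zariski_open_bigU K n).

(* A^r(K) x (K \ {0})^s as a subset of A^(r+s)(K). *)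
Definition affine_torus (K : fieldType) (r s : nat) : set (affine K (r + s)) :=
  [set y | forall j : 'I_s, y (rshift r j) != 0].

Arguments affine_torus : clear implicits.

(** * The binoid F/(f = g) and its K-spectrum *)

Definition binomial_binoid n (f g : {ffun 'I_n -> nat}) : binoidType :=
  quot_binoid (free_of f) (free_of g).

Definition kcoord (K : fieldType) n (f g : {ffun 'I_n -> nat})
    (phi : kspec K (binomial_binoid f g)) : affine K n :=
  fun i => phi (quot_pi (free_of f) (free_of g) (free_var i)).

Definition binomial_kspec (K : fieldType) n (f g : {ffun 'I_n -> nat}) : Type :=
  initial_topology (@kcoord K n f g).

HB.instance Definition _ (K : fieldType) n (f g : {ffun 'I_n -> nat}) :=
  Topological.copy (binomial_kspec K f g) (initial_topology (@kcoord K n f g)).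

(* The value at [x] of the monomial of an element of the free binoid. *)
Definition free_eval (K : fieldType) n (x : affine K n) (a : free_binoid n) : K :=
  if a is Some h then \prod_i x i ^+ h i else 0.

Lemma free_evalD (K : fieldType) n (x : affine K n) (a b : free_binoid n) :
  free_eval x (a + b) = free_eval x a * free_eval x b.
Proof.
case: a b => [u|] [v|] /=; rewrite ?mulr0 ?mul0r //.
by rewrite -big_split /=; apply: eq_bigr => i _; rewrite ffunE exprD.
Qed.

Lemma free_eval0 (K : fieldType) n (x : affine K n) : free_eval x 0 = 1.
Proof. by apply: big1 => i _; rewrite ffunE expr0. Qed.

Lemma free_eval_cong (K : fieldType) n (f g : {ffun 'I_n -> nat})
    (x : affine K n) (a b : free_binoid n) :
    free_eval x (free_of f) = free_eval x (free_of g) ->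
  gen_cong (free_of f) (free_of g) a b -> free_eval x a = free_eval x b.
Proof.
move=> fg; elim=> // [? ? ? _ -> //|c d e _ cd].
by rewrite !free_evalD cd.
Qed.

Lemma free_sum n (h : {ffun 'I_n -> nat}) :
  free_of h = \sum_i free_var i *+ h i.
Proof.
have freeD : {morph @free_of n : u v / u + v} by [].
have freeMn u m : free_of u *+ m = free_of (u *+ m).
  by elim: m => // m IH; rewrite !mulrS IH.
transitivity (free_of (\sum_i [ffun j => (j == i) : nat] *+ h i)).
  congr free_of; apply/ffunP => j; rewrite sum_ffunE (bigD1 j) //=.
  rewrite big1 => [|i ij]; rewrite !ffunMnE ffunE 1?eq_sym.
    by rewrite eqxx addr0 natn.
  by rewrite (negbTE ij) mul0rn.
rewrite (big_morph _ freeD erefl).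
by apply: eq_bigr => i _; rewrite -freeMn.
Qed.

Lemma kspecE (K : fieldType) n (f g : {ffun 'I_n -> nat})
    (phi : kspec K (binomial_binoid f g)) (a : free_binoid n) :
  phi (quot_pi (free_of f) (free_of g) a) = free_eval (kcoord phi) a.
Proof.
set P := quot_pi _ _.
have PD u v : P (u + v) = P u + P v by rewrite [RHS]quot_add_pi.
have phiP0 : phi (P 0) = 1 by exact: kval0.
have phiPD : {morph (fun u => phi (P u)) : u v / u + v >-> u * v}.
  by move=> u v /=; rewrite PD kvalD.
case: a => [h|]; last exact: kval_infty.
rewrite -[Some h]/(free_of h) {1}free_sum (big_morph _ phiPD phiP0) /=.
apply: eq_bigr => i _; rewrite /kcoord -/P; elim: (h i) => [|m IH].
  by rewrite mulr0n expr0.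
by rewrite mulrS phiPD IH exprS.
Qed.

Lemma kcoord_inj (K : fieldType) n (f g : {ffun 'I_n -> nat}) :
  injective (@kcoord K n f g).
Proof.
move=> phi psi phipsi.
have E : kval phi = kval psi.
  by apply/funext; elim/quot_ind => a; rewrite !kspecE phipsi.
case: phi psi E {phipsi} => [u u0 uD ui] [v v0 vD vi] /= uv.
by subst v; congr KPoint; exact: Prop_irrelevance.
Qed.

(* With [kcoord_inj]: the coordinates identify the K-spectrum with the zero set
   of X^f - X^g. *)
Lemma range_kcoord (K : fieldType) n (f g : {ffun 'I_n -> nat}) :
  range (@kcoord K n f g) =
  [set x | \prod_i x i ^+ f i = \prod_i x i ^+ g i].
Proof.
apply/seteqP; split=> x /=.
  move=> [phi _ <-].
  rewrite -[LHS]/(free_eval (kcoord phi) (free_of f)).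
  rewrite -[RHS]/(free_eval (kcoord phi) (free_of g)) -!kspecE.
  by congr (kval phi); apply/quot_piP; exact: gen_cong_rel.
move=> fg; pose v (u : binomial_binoid f g) : K :=
  free_eval x (repr (u : quot_binoid (free_of f) (free_of g))).
have vE a : v (quot_pi (free_of f) (free_of g) a) = free_eval x a.
  apply: (free_eval_cong fg); apply/quot_piP.
  by rewrite /quot_pi reprK.
have v0 : v 0 = 1 by rewrite -(free_eval0 x); exact: vE.
have vi : v binfty = 0 by exact: (vE None).
have vD a b : v (a + b) = v a * v b.
  elim/quot_ind: a => a; elim/quot_ind: b => b.
  by rewrite [_ + _]quot_add_pi !vE free_evalD.
exists (KPoint v0 vD vi) => //; apply/funext => i; rewrite /kcoord /= vE /=.
rewrite (bigD1 i) //= big1 => [|j ji]; rewrite ffunE.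
  by rewrite eqxx expr1 mulr1.
by rewrite (negbTE ji) expr0.
Qed.

(** * Connectedness and isomorphism of spaces *)

Definition connected_space (T : topologicalType) : Prop :=
  [set: T] !=set0 /\ connected [set: T].

Definition disconnected_space (T : topologicalType) : Prop :=
  [set: T] !=set0 /\ ~ connected [set: T].

Lemma connected_spaceP (T : topologicalType) :
  connected_space T <->
  [set: T] !=set0 /\
  ~ exists U V : set T, [/\ open U /\ open V, U !=set0 /\ V !=set0,
      U `&` V = set0 & U `|` V = [set: T]].
Proof.
split=> -[T0 cT]; split=> //.
  move=> [U [V [[oU oV] [U0 [v Vv]] UV0 UVT]]].
  have VCU : U = ~` V.
    apply/seteqP; split=> x.
      by move=> Ux Vx; rewrite -[False]/(set0 x) -UV0.
    by move=> nVx; have : [set: T] x by []; rewrite -UVT => -[].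
  have UT : U = [set: T].
    apply: cT => //; first by exists U; rewrite ?setTI.
    by exists U; rewrite ?setTI // VCU; exact: open_closedC.
  suff : U v by rewrite VCU.
  by rewrite UT.
move=> B B0 [C oC]; rewrite setTI => BC [D cD]; rewrite setTI => BD.
apply: contrapT => BT; apply: cT; exists B, (~` B); split.
- by split; [rewrite BC|rewrite BD; exact: closed_openC].
- split=> //; apply: contrapT => /nonemptyPn CB0; apply: BT.
  by rewrite -[B]setCK CB0 setC0.
- by rewrite setICr.
- by rewrite setUCr.
Qed.

(* Regular functions on a subset of affine space given by an embedding [e]:
   locally quotients of polynomials. *)
Definition regular_fun (K : fieldType) n (T : Type) (e : T -> affine K n)
    (u : T -> K) : Prop :=
  forall x, exists p q : {mpoly K[n]},
    q.@[e x] != 0 /\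
    forall y, q.@[e y] != 0 ->
      u y = p.@[e y] / q.@[e y].

(* Isomorphism of varieties embedded in affine spaces by [e] and [d]: mutually
   inverse continuous maps with regular coordinates. *)
Definition isomorphic_varieties (K : fieldType) n m (S T : topologicalType)
    (e : S -> affine K n) (d : T -> affine K m) : Prop :=
  exists (phi : S -> T) (psi : T -> S),
    [/\ cancel phi psi /\ cancel psi phi,
        continuous phi /\ continuous psi,
        forall j, regular_fun e (fun x => d (phi x) j)
      & forall i, regular_fun d (fun y => e (psi y) i)].

(* Main.v *)
Require Import Defs.
From HB Require Import structures.
From mathcomp.multinomials Require Import mpoly.
From mathcomp Require Import all_boot all_order all_algebra ring zify.
From mathcomp Require Import all_classical topology.

(** K-spec M is the zero set of X^f - X^g. Connectedness comes from curves: if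
    the weights w satisfy w.f = w.g, then t |-> (t^(w_i) x_i) stays in the zero
    set and joins x to its limit at t = 0; suitable weights contract everything
    to the origin in (3) and in the connected case of (2). In the disconnected
    case of (2) the factors X^g and X^f' - 1 have no common zero.

    For g = 0 and f <> 0 let d be the gcd of the f_i. If d = 1, completing f to a
    unimodular integer matrix (Smith normal form) gives a Laurent-monomial
    isomorphism of X^f = 1 with A^r x (K \ {0})^s, which is irreducible. If
    d > 1, then f/d is a torsion element, and X^(f/d) - 1 and
    \sum_(k < d) X^(k f/d) split the zero set into two disjoint nonempty closed
    pieces, as K has a nontrivial d-th root of unity and d is invertible. *)

Set Implicit Arguments.
Unset Strict Implicit.
Unset Printing Implicit Defensive.

Import GRing.Theory.
Local Open Scope classical_set_scope.
Local Open Scope ring_scope.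

(** * Regular functions and the Zariski topology *)

Definition zariski_embedded (K : fieldType) n (T : topologicalType)
    (e : T -> affine K n) : Prop :=
  forall U : set T, open U <-> exists2 V, open V & e @^-1` V = U.

Lemma kcoord_embedded (K : fieldType) n (f g : {ffun 'I_n -> nat}) :
  zariski_embedded (@kcoord K n f g : binomial_kspec K f g -> affine K n).
Proof. by []. Qed.

Lemma affine_torus_embedded (K : fieldType) r s :
  zariski_embedded (fun y : affine_torus K r s => set_val y).
Proof. by []. Qed.

Section RegularFunctions.
Variables (K : fieldType) (n : nat) (T : topologicalType) (e : T -> affine K n).

Lemma regular_cst (c : K) : regular_fun e (fun=> c).
Proof.
move=> x; exists c%:MP, 1; rewrite meval1 oner_eq0; split=> // y _.
by rewrite mevalC meval1 divr1.
Qed.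

Lemma regular_coord i : regular_fun e (fun x => e x i).
Proof.
move=> x; exists 'X_i, 1; rewrite meval1 oner_eq0; split=> // y _.
by rewrite mevalXU meval1 divr1.
Qed.

Lemma regular_add u v :
  regular_fun e u -> regular_fun e v -> regular_fun e (fun x => u x + v x).
Proof.
move=> ru rv x; have [p [q [qx uE]]] := ru x; have [p' [q' [q'x vE]]] := rv x.
exists (p * q' + p' * q), (q * q').
rewrite mevalM mulf_neq0 //; split=> // y.
rewrite mevalM mulf_eq0 negb_or => /andP[qy q'y].
by rewrite uE // vE // mevalD !mevalM addf_div.
Qed.

Lemma regular_mul u v :
  regular_fun e u -> regular_fun e v -> regular_fun e (fun x => u x * v x).
Proof.
move=> ru rv x; have [p [q [qx uE]]] := ru x; have [p' [q' [q'x vE]]] := rv x.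
exists (p * p'), (q * q').
rewrite mevalM mulf_neq0 //; split=> // y.
rewrite mevalM mulf_eq0 negb_or => /andP[qy q'y].
by rewrite uE // vE // mevalM mulf_div.
Qed.

Lemma regular_inv u :
  (forall x, u x != 0) -> regular_fun e u -> regular_fun e (fun x => (u x)^-1).
Proof.
move=> u0 ru x; have [p [q [qx uE]]] := ru x.
have px : p.@[e x] != 0.
  by have := u0 x; rewrite uE // mulf_eq0 negb_or => /andP[].
(* The extra factor q keeps the denominator nonzero only where u = p / q is known to hold. *)
exists (q * q), (p * q); rewrite mevalM mulf_neq0 //; split=> // y.
rewrite mevalM mulf_eq0 negb_or => /andP[py qy].
by rewrite uE // invf_div mevalM -mulf_div divff // mulr1.
Qed.

Lemma regular_sum (I : Type) (r : seq I) (u : I -> T -> K) :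
  (forall i, regular_fun e (u i)) ->
  regular_fun e (fun x => \sum_(i <- r) u i x).
Proof.
move=> ru; elim: r => [|i r IH].
  under eq_fun do rewrite big_nil; exact: regular_cst.
under eq_fun do rewrite big_cons; exact: regular_add.
Qed.

Lemma regular_prod (I : Type) (r : seq I) (u : I -> T -> K) :
  (forall i, regular_fun e (u i)) ->
  regular_fun e (fun x => \prod_(i <- r) u i x).
Proof.
move=> ru; elim: r => [|i r IH].
  under eq_fun do rewrite big_nil; exact: regular_cst.
under eq_fun do rewrite big_cons; exact: regular_mul.
Qed.

Lemma regular_exp u m : regular_fun e u -> regular_fun e (fun x => u x ^+ m).
Proof.
move=> ru; elim: m => [|m IH].
  under eq_fun do rewrite expr0; exact: regular_cst.
under eq_fun do rewrite exprS; exact: regular_mul.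
Qed.

Lemma regular_exprz u (m : int) :
  (forall x, u x != 0) -> regular_fun e u -> regular_fun e (fun x => u x ^ m).
Proof.
move=> u0 ru; case: m => m; first exact: regular_exp.
under eq_fun do rewrite NegzE -exprnN -exprVn.
by apply: regular_exp; exact: regular_inv.
Qed.

Hypothesis eE : zariski_embedded e.

Lemma open_meval_neq0 (p : {mpoly K[n]}) : open [set x | p.@[e x] != 0].
Proof.
apply/eE; exists [set z : affine K n | p.@[z] != 0] => //.
exists [set p]; apply/seteqP; split=> z /=.
  by move=> pz /(_ p erefl)/eqP; apply/negP.
by move=> pz; apply/negP => /eqP pz0; apply: pz => _ ->.
Qed.

(** Where u = p / q locally, the basic open set on which p q does not vanish is a neighbourhood
    contained in this set. *)
Lemma regular_open_neq0 u : regular_fun e u -> open [set x | u x != 0].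
Proof.
move=> ru; rewrite openE => x /= ux; have [p [q [qx uE]]] := ru x.
rewrite /interior nbhsE; exists [set y | (p * q).@[e y] != 0].
  split; first exact: open_meval_neq0.
  move: ux; rewrite /= uE // mulf_eq0 negb_or => /andP[px _].
  by rewrite mevalM mulf_neq0.
move=> y /=; rewrite mevalM mulf_eq0 negb_or => /andP[py qy].
by rewrite uE // mulf_neq0 // invr_eq0.
Qed.

(** The preimage of an open set is a union of nonvanishing sets of polynomials in the coordinates of
    [phi], which are again regular functions. *)
Lemma regular_continuous m (S : topologicalType) (d : S -> affine K m)
    (phi : T -> S) :
    zariski_embedded d -> (forall j, regular_fun e (fun x => d (phi x) j)) ->
  continuous phi.
Proof.
move=> dE rphi; apply/continuousP => _ /dE[_ [P ->] <-].
have -> : phi @^-1` (d @^-1` (~` [set z | forall p, P p -> p.@[z] = 0])) =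
    \bigcup_(p in P) [set x | p.@[d (phi x)] != 0].
  apply/seteqP; split=> x /=.
    by move=> /existsNP[p /not_implyP[Pp /eqP px]]; exists p.
  by move=> [p Pp /= /eqP px] /(_ p Pp).
apply: bigcup_open => p _; apply: regular_open_neq0.
under eq_fun do rewrite mevalE.
apply: regular_sum => k; apply: regular_mul; first exact: regular_cst.
by apply: regular_prod => i; exact: regular_exp.
Qed.

End RegularFunctions.

(** * Irreducibility of A^r x (K \ {0})^s *)

Lemma meval_line (K : comNzRingType) n (x y : 'I_n -> K) (p : {mpoly K[n]}) :
  exists P : {poly K}, forall t, P.[t] = p.@[fun i => x i + (y i - x i) * t].
Proof.
exists (\sum_(m <- msupp p)
  p@_m *: \prod_i ((x i)%:P + (y i - x i) *: 'X) ^+ m i) => t.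
rewrite mevalE horner_sum; apply: eq_bigr => m _.
rewrite hornerZ horner_prod; congr (_ * _); apply: eq_bigr => i _.
by rewrite !hornerE.
Qed.

(* On the line through a point of U and a point of V, being outside U, outside V
   or outside the torus are each the vanishing of a nonzero polynomial in t. *)
Lemma affine_torus_irreducible (K : closedFieldType) r s
    (U V : set (affine_torus K r s)) :
  open U -> open V -> U !=set0 -> V !=set0 -> U `&` V !=set0.
Proof.
move=> [_ [S ->] <-] [_ [S' ->] <-].
move=> [x /existsNP[p /not_implyP[Sp /eqP px]]].
move=> [y /existsNP[q /not_implyP[Sq /eqP qy]]].
pose l (t : K) : affine K (r + s) :=
  fun i => set_val x i + (set_val y i - set_val x i) * t.
have l0 : l 0 = set_val x by apply/funext => i; rewrite /l mulr0 addr0.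
have l1 : l 1 = set_val y by apply/funext => i; rewrite /l mulr1 subrKC.
have [P PE] := meval_line (set_val x) (set_val y) p.
have [Q QE] := meval_line (set_val x) (set_val y) q.
have [R RE] := meval_line (set_val x) (set_val y) (\prod_j 'X_(rshift r j)).
have P0 : P != 0.
  by apply: contraNneq px => P0; rewrite -l0 -PE P0 horner0.
have Q0 : Q != 0.
  by apply: contraNneq qy => Q0; rewrite -l1 -QE Q0 horner0.
have RlE t : R.[t] = \prod_j l t (rshift r j).
  by rewrite RE rmorph_prod /=; apply: eq_bigr => j _; rewrite mevalXU.
have R0 : R != 0.
  apply: contraTneq isT => R0.
  have : \prod_j l 0 (rshift r j) != 0.
    apply/prodf_neq0 => j _; rewrite l0; exact: (set_mem (valP x)).
  by rewrite -RlE R0 horner0 eqxx.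
have /closed_nonrootP[t] : P * Q * R != 0 by rewrite !mulf_neq0.
rewrite /root !hornerM !mulf_eq0 !negb_or => /andP[/andP[Pt Qt]].
rewrite RlE => /prodf_neq0 Rt.
have lt : l t \in affine_torus K r s by apply/mem_set => j; exact: Rt.
exists (exist _ (l t) lt); split=> /=.
  by move=> /(_ p Sp) /eqP; apply/negP; rewrite -PE.
by move=> /(_ q Sq) /eqP; apply/negP; rewrite -QE.
Qed.

(** A proper nonempty clopen set and its complement would be disjoint nonempty open sets, against
    irreducibility. *)
Lemma affine_torus_connected (K : closedFieldType) r s :
  connected [set: affine_torus K r s].
Proof.
move=> B B0 [C oC]; rewrite setTI => BC [D cD]; rewrite setTI => BD.
apply: contrapT => BT; have [||||x []] := @affine_torus_irreducible K r s B (~` B).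
- by rewrite BC.
- by rewrite BD; exact: closed_openC.
- by [].
- apply: contrapT => /nonemptyPn CB0; apply: BT.
  by rewrite -[B]setCK CB0 setC0.
- by [].
Qed.

(** * Monomials on the zero set of X^f - X^g *)

Section BinomialSpectrum.
Variables (K : fieldType) (n : nat).
Implicit Types (x : affine K n) (f g h : {ffun 'I_n -> nat}).

Definition monomial x h : K := free_eval x (free_of h).

Lemma monomialD x f g : monomial x (f + g) = monomial x f * monomial x g.
Proof. exact: free_evalD x (free_of f) (free_of g). Qed.

Lemma monomial0 x : monomial x 0 = 1.
Proof. exact: free_eval0. Qed.

Lemma monomialMn x h m : monomial x (h *+ m) = monomial x h ^+ m.
Proof.
elim: m => [|m IH]; first by rewrite mulr0n monomial0.
by rewrite mulrS monomialD IH exprS.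
Qed.

Lemma monomial_one h : monomial (fun=> 1) h = 1.
Proof. by apply: big1 => i _; rewrite expr1n. Qed.

Lemma monomial_eq0 x h :
  (monomial x h == 0) = [exists i, (i \in supp h) && (x i == 0)].
Proof.
apply/prodf_eq0/existsP => [[i _]|[i /andP[]]].
  rewrite expf_eq0 => /andP[hi xi]; exists i.
  by rewrite inE -lt0n hi.
by rewrite inE => hi xi; exists i; rewrite // expf_eq0 lt0n hi.
Qed.

Lemma monomial_at0 h : h <> 0 -> monomial (fun=> 0) h = 0.
Proof.
move=> h0; apply/eqP; rewrite monomial_eq0; apply/existsP.
apply: contrapT => /forallNP hN; apply: h0; apply/ffunP => i.
by rewrite ffunE; apply/eqP/negPn/negP => hi; apply: (hN i); rewrite inE hi eqxx.
Qed.

Lemma regular_monomial (T : topologicalType) (e : T -> affine K n) h :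
  regular_fun e (fun z => monomial (e z) h).
Proof.
apply: regular_prod => i; apply: regular_exp; exact: regular_coord.
Qed.

(** The exponent of t is the weighted degree of [h], so the scaling preserves the equation X^f = X^g
    when both sides have the same degree. *)
Lemma monomial_weight x (w : 'I_n -> nat) (t : K) h :
  monomial (fun i => x i * t ^+ w i) h =
  monomial x h * t ^+ (\sum_i w i * h i)%N.
Proof.
rewrite -prodrXr -big_split; apply: eq_bigr => i _ /=.
by rewrite exprMn -exprM.
Qed.

Variables f g : {ffun 'I_n -> nat}.
Local Notation X := (binomial_kspec K f g).

Lemma kcoordP (phi : X) : monomial (kcoord phi) f = monomial (kcoord phi) g.
Proof. by have : range (@kcoord K n f g) (kcoord phi); [exists phi|rewrite range_kcoord]. Qed.

Lemma kcoord_onto x :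
  monomial x f = monomial x g -> exists phi : X, kcoord phi = x.
Proof.
move=> fg; have : range (@kcoord K n f g) x by rewrite range_kcoord.
by move=> [phi _ <-]; exists phi.
Qed.

Lemma binomial_kspec_nonempty : [set: X] !=set0.
Proof.
(* The all-ones point solves every equation X^f = X^g. *)
by have [|phi _] := @kcoord_onto (fun=> 1); [rewrite !monomial_one|exists phi].
Qed.

End BinomialSpectrum.

(** * Criteria for connectedness *)

Lemma not_connected_regular (K : fieldType) n (T : topologicalType)
    (e : T -> affine K n) (u v : T -> K) (x y : T) :
    zariski_embedded e -> regular_fun e u -> regular_fun e v ->
    (forall z, u z * v z = 0) -> (forall z, u z = 0 -> v z != 0) ->
    u x != 0 -> v y != 0 ->
  ~ connected_space T.
Proof.
move=> eE ru rv uv0 uNv ux vy /connected_spaceP[_]; apply.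
(* These open sets are disjoint because u v = 0 and cover [T] because u and v have no common
   zero. *)
exists [set z | u z != 0], [set z | v z != 0]; split.
- by split; exact: regular_open_neq0.
- by split; [exists x|exists y].
- apply/seteqP; split=> // z [/= uz vz].
  by have := mulf_neq0 uz vz; rewrite uv0 eqxx.
- apply/seteqP; split=> // z _ /=.
  by have [/uNv|] := eqVneq (u z) 0; [right|left].
Qed.

Lemma connected_component_image (S T : topologicalType) (phi : S -> T) (a b : S) :
    connected [set: S] -> continuous phi ->
  connected_component [set: T] (phi a) (phi b).
Proof.
move=> cS cphi.
pose A : set T := [set phi x | x in [set: S]].
have cA : connected A.
  by apply: connected_continuous_connected => //; exact: continuous_subspaceT.
have sA : A `<=` connected_component [set: T] (phi a).
  by apply: connected_component_max => //; exists a.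
by apply: sA; exists b.
Qed.

Lemma connected_space_star (T : topologicalType) (a : T) :
  (forall x, connected_component [set: T] x a) -> connected_space T.
Proof.
move=> Ta; split; first by exists a.
have <- : connected_component [set: T] a = [set: T].
  by apply/seteqP; split=> // x _; exact: connected_component_sym.
exact: component_connected.
Qed.

(* The curve t |-> (t^(w i) x_i) joins x (t = 1) to its limit (t = 0, where
   0 ^+ 0 = 1). *)
Lemma weighted_contraction (K : closedFieldType) n (f g : {ffun 'I_n -> nat})
    (w : 'I_n -> nat) (phi psi : binomial_kspec K f g) :
    (forall t, monomial (fun i => kcoord phi i * t ^+ w i) f =
               monomial (fun i => kcoord phi i * t ^+ w i) g) ->
    (forall i, kcoord psi i = kcoord phi i * 0 ^+ w i) ->
  connected_component [set: binomial_kspec K f g] phi psi.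
Proof.
move=> wfg psiE; have /choice[c cE] := fun t => kcoord_onto (wfg t).
(* The affine line is taken as [affine_torus K 1 0], already known to be connected; [par] is its
   coordinate. *)
pose par (y : affine_torus K 1 0) : K := set_val y (lshift 0 ord0).
have line t : exists y, par y = t.
  pose y : affine K (1 + 0) := fun=> t.
  have ty : y \in affine_torus K 1 0 by apply/mem_set => -[].
  by exists (exist _ y ty).
have [y0 y0E] := line 0; have [y1 y1E] := line 1.
have <- : c (par y1) = phi.
  by apply: kcoord_inj; rewrite cE y1E; apply/funext => i; rewrite expr1n mulr1.
have <- : c (par y0) = psi.
  by apply: kcoord_inj; rewrite cE y0E; apply/funext => i; rewrite psiE.
apply: (@connected_component_image _ _ (c \o par)).
  exact: affine_torus_connected.
apply: (regular_continuous (@affine_torus_embedded K 1 0)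
  (@kcoord_embedded K n f g)) => j.
have -> : (fun y => kcoord (c (par y)) j) =
          (fun y => kcoord phi j * par y ^+ w j).
  by apply/funext => y; rewrite cE.
apply: regular_mul; first exact: regular_cst.
by apply: regular_exp; exact: regular_coord.
Qed.

(** * Relations with g nonzero *)

Lemma disconnected_of_supp_subset (K : fieldType) n (f' g : {ffun 'I_n -> nat}) :
    g <> 0 -> supp g \subset supp f' ->
  ~ connected_space (binomial_kspec K (f' + g) g).
Proof.
move=> g0 /fintype.subsetP gf.
have f0 : f' <> 0.
  move=> f0; apply: g0; apply/ffunP => i; rewrite ffunE; apply/eqP/negPn/negP => gi.
  by have := gf i; rewrite !inE gi f0 ffunE eqxx => /(_ isT).
have [|phi1 phi1E] := @kcoord_onto K n (f' + g) g (fun=> 1).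
  by rewrite !monomial_one.
have [|phi0 phi0E] := @kcoord_onto K n (f' + g) g (fun=> 0).
  by rewrite monomialD monomial_at0 ?mul0r // monomial_at0.
(* The equation factors as X^g (X^f' - 1) = 0. A zero of X^g has a zero coordinate in supp g, hence
   in supp f', so X^f' vanishes there too. The all-ones point and the origin lie in different
   pieces. *)
apply: (@not_connected_regular K n (binomial_kspec K (f' + g) g) (@kcoord K n (f' + g) g)
  (fun z => monomial (kcoord z) g) (fun z => monomial (kcoord z) f' - 1) phi1 phi0).
- exact: kcoord_embedded.
- exact: regular_monomial.
- apply: regular_add; [exact: regular_monomial|exact: regular_cst].
- by move=> z; rewrite mulrBr mulr1 mulrC -monomialD kcoordP subrr.
- move=> z /eqP; rewrite monomial_eq0 => /existsP[i /andP[/gf fi zi]].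
  suff /eqP-> : monomial (kcoord z) f' == 0 by rewrite sub0r oppr_eq0 oner_eq0.
  by rewrite monomial_eq0; apply/existsP; exists i; rewrite fi zi.
- by rewrite phi1E monomial_one oner_eq0.
- by rewrite phi0E monomial_at0 // sub0r oppr_eq0 oner_eq0.
Qed.

(** Take i0 in supp g outside supp f'. Scaling the coordinate i0 alone multiplies both monomials by
    the same power of t and leads to a point with X^g = 0; from there a uniform scaling leads to the
    origin. *)
Lemma connected_of_not_supp_subset (K : closedFieldType) n
    (f' g : {ffun 'I_n -> nat}) :
    ~~ (supp g \subset supp f') ->
  connected_space (binomial_kspec K (f' + g) g).
Proof.
move=> /subsetPn[i0]; rewrite !inE negbK => gi /eqP fi.
have g0 : g <> 0 by move=> g0; move: gi; rewrite g0 ffunE.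
have [|a aE] := @kcoord_onto K n (f' + g) g (fun=> 0).
  by rewrite monomialD [X in _ * X]monomial_at0 ?mulr0 ?monomial_at0.
apply: (@connected_space_star _ a) => phi.
pose x : affine K n := fun i => kcoord phi i * 0 ^+ (i == i0).
have xg : monomial x g = 0.
  apply/eqP; rewrite monomial_eq0; apply/existsP; exists i0.
  by rewrite inE gi /x eqxx expr1 mulr0 eqxx.
have [|b bE] := @kcoord_onto K n (f' + g) g x; first by rewrite monomialD xg mulr0.
apply: (@connected_component_trans _ _ b).
  apply: (@weighted_contraction K n _ _ (fun i => i == i0)); last by rewrite bE.
  move=> t; rewrite !monomial_weight kcoordP; congr (_ * _ ^+ _).
  apply: eq_bigr => i _; rewrite ffunE.
  by case: eqP => [->|]; rewrite ?mul0n // fi add0r.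
(* Both monomials vanish at [b] and stay zero under scaling, so their degrees may differ. *)
apply: (@weighted_contraction K n _ _ (fun=> 1%N)) => [t|i]; last first.
  by rewrite aE expr1 mulr0.
rewrite !monomial_weight monomialD bE xg; ring.
Qed.

(** Since the supports are disjoint, positive weights can be chosen separately on them to give f'
    and g' equal degree. Adding h preserves this equality, so every point contracts to the
    origin. *)
Lemma connected_of_disjoint_supp (K : closedFieldType) n
    (f' g' h : {ffun 'I_n -> nat}) :
    supp f' <> finset.set0 -> supp g' <> finset.set0 ->
    supp f' :&: supp g' = finset.set0 ->
  connected_space (binomial_kspec K (f' + h) (g' + h)).
Proof.
move=> f0 g0 fg0.
have sumsupp (u : {ffun 'I_n -> nat}) : supp u <> finset.set0 -> (0 < \sum_i u i)%N.
  move/eqP/set0Pn => [i]; rewrite inE -lt0n => ui.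
  by rewrite (bigD1 i) //= addn_gt0 ui.
have suppN0 (u v : {ffun 'I_n -> nat}) : supp u <> finset.set0 -> u + v <> 0.
  move/eqP/set0Pn => [i]; rewrite inE => ui uv0.
  by have := congr1 (fun z : {ffun 'I_n -> nat} => z i) uv0; rewrite !ffunE; case: (u i) ui.
(* |g'| on supp f', |f'| on supp g': both sides get the weight |f'| |g'|. *)
pose w i := if i \in supp f' then (\sum_j g' j)%N
            else if i \in supp g' then (\sum_j f' j)%N else 1%N.
have wf : (\sum_i w i * f' i = (\sum_j g' j) * \sum_j f' j)%N.
  rewrite big_distrr /=; apply: eq_bigr => i _; rewrite /w.
  by case: ifPn => //; rewrite inE negbK => /eqP->; rewrite !muln0.
have wg : (\sum_i w i * g' i = (\sum_j g' j) * \sum_j f' j)%N.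
  rewrite mulnC big_distrr /=; apply: eq_bigr => i _; rewrite /w.
  have [fi|_] := boolP (i \in supp f').
    have : i \notin supp g'.
      apply/negP => gi; have : i \in supp f' :&: supp g' by rewrite inE fi gi.
      by rewrite fg0 inE.
    by rewrite inE negbK => /eqP->; rewrite !muln0.
  by case: ifPn => //; rewrite inE negbK => /eqP->; rewrite !muln0.
have w_gt0 i : (0 < w i)%N.
  by rewrite /w; case: ifP => _; [|case: ifP => _ //]; exact: sumsupp.
have [|a aE] := @kcoord_onto K n (f' + h) (g' + h) (fun=> 0).
  by rewrite !monomial_at0 //; exact: suppN0.
apply: (@connected_space_star _ a) => phi.
apply: (@weighted_contraction K n _ _ w) => [t|i]; last first.
  by rewrite aE expr0n eqn0Ngt w_gt0 mulr0.
rewrite !monomial_weight kcoordP; congr (_ * _ ^+ _).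
have wD u v : (\sum_i w i * (u + v : {ffun 'I_n -> nat})%R i =
    \sum_i w i * u i + \sum_i w i * v i)%N.
  by rewrite -big_split; apply: eq_bigr => i _; rewrite /= ffunE mulnDr.
by rewrite !wD wf wg.
Qed.

(** * Isomorphisms and Laurent monomial maps *)

Lemma isomorphic_of_regular (K : fieldType) n m (S T : topologicalType)
    (e : S -> affine K n) (d : T -> affine K m)
    (a : affine K n -> affine K m) (b : affine K m -> affine K n) :
    zariski_embedded e -> zariski_embedded d -> injective e -> injective d ->
    (forall x, exists y, d y = a (e x)) -> (forall y, exists x, e x = b (d y)) ->
    (forall x, b (a (e x)) = e x) -> (forall y, a (b (d y)) = d y) ->
    (forall j, regular_fun e (fun x => a (e x) j)) ->
    (forall i, regular_fun d (fun y => b (d y) i)) ->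
  isomorphic_varieties e d.
Proof.
move=> eE dE e_inj d_inj /choice[phi phiE] /choice[psi psiE] ba ab ra rb.
have rphi j : regular_fun e (fun x => d (phi x) j).
  by under eq_fun do rewrite phiE; exact: ra.
have rpsi i : regular_fun d (fun y => e (psi y) i).
  by under eq_fun do rewrite psiE; exact: rb.
exists phi, psi; split=> //.
- split; first by move=> x; apply: e_inj; rewrite psiE phiE ba.
  by move=> y; apply: d_inj; rewrite phiE psiE ab.
(* Continuity is automatic for maps with regular coordinates. *)
- by split; [apply: (regular_continuous eE dE)|apply: (regular_continuous dE eE)].
Qed.

Lemma isomorphic_torus_connected (K : closedFieldType) n (S : topologicalType)
    (e : S -> affine K n) r s :
    [set: S] !=set0 ->
    isomorphic_varieties e (fun y : affine_torus K r s => set_val y) ->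
  connected_space S.
Proof.
move=> [x0 _] [phi [psi [[phiK _] [_ cpsi] _ _]]].
apply: (@connected_space_star _ x0) => x; rewrite -[x]phiK -[x0]phiK.
by apply: connected_component_image => //; exact: affine_torus_connected.
Qed.

Section LaurentMonomials.
Variables (K : fieldType) (k : nat).
Implicit Types (x : 'I_k -> K) (A B : 'M[int]_k).

(** On nonzero coordinates this is the torus homomorphism with exponent matrix [A]; exponents are
    stored by columns, so that composites correspond to matrix products. *)
Definition laurent_map A x : 'I_k -> K := fun j => \prod_i x i ^ A i j.

Lemma laurent_map_neq0 A x j : (forall i, x i != 0) -> laurent_map A x j != 0.
Proof. by move=> x0; apply/prodf_neq0 => i _; exact: expfz_neq0. Qed.

Lemma exprz_sum (t : K) (I : Type) (r : seq I) (v : I -> int) :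
  t != 0 -> t ^ (\sum_(i <- r) v i) = \prod_(i <- r) t ^ v i.
Proof.
move=> t0; elim: r => [|i r IH]; first by rewrite !big_nil.
by rewrite !big_cons expfzDr // IH.
Qed.

Lemma exprz_prod (I : Type) (r : seq I) (u : I -> K) (v : int) :
  (\prod_(i <- r) u i) ^ v = \prod_(i <- r) u i ^ v.
Proof.
elim: r => [|i r IH]; first by rewrite !big_nil exp1rz.
by rewrite !big_cons expfzMl IH.
Qed.

Lemma laurent_map_mul A B x : (forall i, x i != 0) ->
  laurent_map B (laurent_map A x) = laurent_map (A *m B) x.
Proof.
move=> x0; apply/funext => l; rewrite /laurent_map.
under eq_bigr do rewrite exprz_prod; rewrite exchange_big; apply: eq_bigr => i _ /=.
rewrite mxE exprz_sum //; apply: eq_bigr => j _; exact: exprz_exp.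
Qed.

Lemma laurent_map1 x : laurent_map 1%:M x = x.
Proof.
apply/funext => j; rewrite /laurent_map (bigD1 j) //= big1 => [|i ij].
  by rewrite mxE eqxx expr1z mulr1.
by rewrite mxE (negbTE ij) expr0z.
Qed.

End LaurentMonomials.

(** * Primitive integer vectors and unimodular matrices *)

Lemma smith_column m (F : 'I_m.+1 -> int) :
  exists (A B : 'M[int]_m.+1) (d : int),
    [/\ A *m B = 1%:M, B *m A = 1%:M & forall i, F i = A i 0 * d].
Proof.
have [L uL [R _ [d _ FE]]] := int_Smith_normal_form (\col_i F i).
(* R is 1 x 1 and the diagonal factor has a single column, so only the first column of L
   contributes. Up to sign, the scaling factor is the gcd of the [F i]. *)
exists L, (invmx L), (d`_0 * R 0 0); rewrite mulmxV // mulVmx //; split=> // i.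
have /matrixP/(_ i 0) := FE; rewrite mxE => ->.
rewrite mxE big_ord1 mxE (bigD1 0) //= big1 => [|j j0].
  by rewrite mxE eqxx mulr1n addr0 mulrA.
rewrite mxE; have -> : ((j : nat) == (0 : 'I_1)) = false by apply: negbTE; exact: j0.
by rewrite mulr0n mulr0.
Qed.

(** The Bezout relation forces d = 1 or d = -1 in [smith_column]; multiplying both matrices by [d]
    absorbs the sign. *)
Lemma unimodular_completion m (F u : 'I_m.+1 -> int) :
    \sum_i u i * F i = 1 ->
  exists A B : 'M[int]_m.+1,
    [/\ A *m B = 1%:M, B *m A = 1%:M & forall i, A i 0 = F i].
Proof.
move=> uF; have [A [B [d [AB BA FE]]]] := smith_column F.
have dd : d * d = 1.
  have : (\sum_i u i * A i 0) * d = 1.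
    by rewrite -uF mulr_suml; apply: eq_bigr => i _; rewrite FE mulrA.
  move/(congr1 absz)/eqP; rewrite abszM muln_eq1 => /andP[_ /eqP d1].
  by have [->|->] : d = 1 \/ d = -1 by lia.
exists (d *: A), (d *: B); rewrite -!scalemxAl -!scalemxAr !scalerA dd.
by split; rewrite ?AB ?BA ?scale1r // => i; rewrite mxE FE mulrC.
Qed.

Lemma exponentMnE n (a : {ffun 'I_n -> nat}) m i : (a *+ m) i = (a i * m)%N.
Proof. by rewrite ffunMnE -mulr_natr natn. Qed.

Lemma exponentDE n (a b : {ffun 'I_n -> nat}) i : (a + b) i = (a i + b i)%N.
Proof. by rewrite ffunE. Qed.

(** The cases are |d| = 0, |d| = 1 and |d| > 1 for the signed gcd [d] of the exponents; row 0 of the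
    inverse matrix expresses [d] as a combination of them. *)
Lemma exponent_trichotomy n (f : {ffun 'I_n -> nat}) : (0 < n)%N ->
  [\/ f = 0, exists u : 'I_n -> int, \sum_i u i * (f i)%:Z = 1
    | exists (d : nat) (f1 : {ffun 'I_n -> nat}), [/\ (1 < d)%N, f1 <> 0 & f = f1 *+ d]].
Proof.
case: n f => // n f _; have [->|/eqP f0] := eqVneq f 0; first exact: Or31.
have [A [B [d [AB BA FE]]]] := smith_column (fun i => (f i)%:Z).
have BF : \sum_i B 0 i * (f i)%:Z = d.
  under eq_bigr do rewrite FE mulrA; rewrite -mulr_suml.
  have /matrixP/(_ 0 0) := BA; rewrite !mxE => ->.
  by rewrite eqxx mul1r.
have fE i : f i = (`|A i 0%R| * `|d|)%N by rewrite -abszM -FE.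
have [d0|d1|d1] := ltngtP `|d|%N 1%N.
- have d00 : `|d|%N = 0%N by lia.
  by apply: Or31; apply/ffunP => i; rewrite fE ffunE d00 muln0.
- have f1E : f = [ffun i => `|A i 0%R|%N] *+ `|d|%N.
    by apply/ffunP => i; rewrite exponentMnE ffunE fE.
  apply: Or33; exists `|d|%N, [ffun i => `|A i 0%R|%N]; split=> // f10.
  by apply: f0; rewrite f1E f10 mul0rn.
(* The factor [d] corrects the sign, as d * d = 1. *)
- apply: Or32; exists (fun i => d * B 0 i).
  under eq_bigr do rewrite -mulrA; rewrite -mulr_sumr BF.
  by have [->|->] : d = 1 \/ d = -1 by lia.
Qed.

(** This will send variables outside the support to affine coordinates and those in it to the torus
    block. *)
Lemma subset_enumeration (T : finType) (S : {set T}) r s :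
    #|~: S| = r -> #|S| = s ->
  exists2 h : 'I_r + 'I_s -> T, bijective h &
    (forall a, h (inl a) \notin S) /\ (forall b, h (inr b) \in S).
Proof.
move=> <- <-.
pose h (v : 'I_#|~: S| + 'I_#|S|) : T :=
  match v with inl a => enum_val a | inr b => enum_val b end.
have hl a : h (inl a) \notin S by have := enum_valP a; rewrite inE.
have hr b : h (inr b) \in S by exact: enum_valP.
exists h => //; apply: inj_card_bij; last first.
  by rewrite card_sum !card_ord addnC cardsC.
move=> [a|a] [b|b] hab.
- by congr inl; exact: enum_val_inj hab.
- by have := hl a; rewrite hab hr.
- by have := hl b; rewrite -hab hr.
- by congr inr; exact: enum_val_inj hab.
Qed.

(** * The spectrum of X^f = 1 as an affine space times a torus *)

Section TorusIsomorphism.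
Variables (K : fieldType) (n : nat).

Lemma affine_isomorphism :
  isomorphic_varieties
    (@kcoord K n 0 0 : binomial_kspec K 0 0 -> affine K n)
    (fun y : affine_torus K n 0 => set_val y).
Proof.
(* The value 0 is a dummy: the right summand is the empty type 'I_0. *)
apply: (@isomorphic_of_regular K n (n + 0) (binomial_kspec K 0 0)
  (affine_torus K n 0) _ _
  (fun x j => if fintype.split j is inl a then x a else 0)
  (fun y i => y (lshift 0 i))).
- exact: kcoord_embedded.
- exact: affine_torus_embedded.
- exact: kcoord_inj.
- exact: val_inj.
- move=> x; set y : affine K (n + 0) := fun j => _.
  have yT : y \in affine_torus K n 0 by apply/mem_set => -[].
  by exists (exist _ y yT).
- by move=> y; apply: kcoord_onto.
- move=> x; apply/funext => i.
  by rewrite -[lshift 0 i]/(unsplit (inl i)) unsplitK.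
- move=> y; apply/funext => j; rewrite -[j in RHS]splitK.
  by case: (fintype.split j) => [//|[]].
- move=> j; case: (fintype.split j) => a; [exact: regular_coord|exact: regular_cst].
- by move=> i; exact: regular_coord.
Qed.

Variables (f : {ffun 'I_n -> nat}) (u : 'I_n -> int).
Hypothesis uf1 : \sum_i u i * (f i)%:Z = 1.

(* Completing the exponents of [f] on its support to a unimodular matrix turns
   X^f into a coordinate of the torus; the other coordinates of the torus and
   the variables outside the support are then free. *)
Lemma torus_isomorphism :
  exists r s : nat,
    isomorphic_varieties
      (@kcoord K n f 0 : binomial_kspec K f 0 -> affine K n)
      (fun y : affine_torus K r s => set_val y).
Proof.
have fN0 i : i \notin supp f -> f i = 0%N by rewrite inE negbK => /eqP.
(* The Bezout relation makes the support nonempty. The equation X^f = 1 uses up one coordinate, so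
   the torus has dimension |supp f| - 1. *)
have [s sE] : exists s, #|supp f| = s.+1.
  case sE : #|supp f| => [|s]; last by exists s.
  have /eqP := uf1; rewrite big1 // => i _; rewrite fN0 ?mulr0 //.
  by rewrite (cards0_eq sE) inE.
pose r := #|~: supp f|; exists r, s.
have [h [t ht th] [hC hS]] := subset_enumeration (erefl r) sE.
have hl a : f (h (inl a)) = 0%N by apply: fN0; exact: hC.
have split_h (R : Type) (idx : R) (op : Monoid.com_law idx) (F : 'I_n -> R) :
    \big[op/idx]_i F i =
    op (\big[op/idx]_a F (h (inl a))) (\big[op/idx]_b F (h (inr b))).
  by rewrite (reindex h) /= ?big_sumType //; exists t => x _.
have [|A [B [AB BA AE]]] :=
    @unimodular_completion s (fun b => (f (h (inr b)))%:Z) (u \o (h \o inr)).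
  rewrite -uf1 split_h /= [X in _ = X + _]big1 ?add0r // => a _.
  by rewrite hl mulr0.
have monE (x : affine K n) :
    monomial x f = laurent_map A (fun b => x (h (inr b))) ord0.
  rewrite /monomial /= split_h /= [X in X * _ = _]big1 ?mul1r => [|a _]; last by rewrite hl expr0.
  by apply: eq_bigr => b _; rewrite AE.
have xN0 (p : binomial_kspec K f 0) b : kcoord p (h (inr b)) != 0.
  have : monomial (kcoord p) f != 0 by rewrite kcoordP monomial0 oner_eq0.
  rewrite monomial_eq0 negb_exists => /forallP/(_ (h (inr b))).
  by rewrite negb_and => /orP[|//]; rewrite hS.
(* [z] reinserts at index 0 the coordinate X^f, equal to 1 on the spectrum, which the map [a] below
   drops. *)
pose z (y : affine K (r + s)) (b : 'I_s.+1) : K :=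
  if unlift ord0 b is Some c then y (rshift r c) else 1.
have zN0 (y : affine_torus K r s) b : z (set_val y) b != 0.
  rewrite /z; case: unliftP => [c _|_]; last exact: oner_neq0.
  exact: (set_mem (valP y)).
pose a (x : affine K n) : affine K (r + s) := fun j =>
  match fintype.split j with
  | inl c => x (h (inl c))
  | inr c => laurent_map A (fun b => x (h (inr b))) (lift ord0 c)
  end.
pose b (y : affine K (r + s)) : affine K n := fun i =>
  match t i with
  | inl c => y (lshift s c)
  | inr c => laurent_map B (z y) c
  end.
have bh y : (fun c => b y (h (inr c))) = laurent_map B (z y).
  by apply/funext => c; rewrite /b ht.
have za (p : binomial_kspec K f 0) : z (a (kcoord p)) = laurent_map A (fun c => kcoord p (h (inr c))).
  apply/funext => c; rewrite /z; case: unliftP => [c' ->|->].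
    by rewrite /a -[rshift r c']/(unsplit (inr c')) unsplitK.
  by rewrite -(monE (kcoord p)) kcoordP monomial0.
apply: (@isomorphic_of_regular K n (r + s) (binomial_kspec K f 0)
  (affine_torus K r s) _ _ a b).
- exact: kcoord_embedded.
- exact: affine_torus_embedded.
- exact: kcoord_inj.
- exact: val_inj.
- move=> p; have yT : a (kcoord p) \in affine_torus K r s.
    apply/mem_set => c; rewrite /a -[rshift r c]/(unsplit (inr c)) unsplitK.
    exact: laurent_map_neq0.
  by exists (exist _ (a (kcoord p)) yT).
(* X^f at the image of y is coordinate 0 of [z y], which is 1. *)
- move=> y; apply: kcoord_onto; rewrite monE bh laurent_map_mul // BA.
  by rewrite laurent_map1 monomial0 /z unlift_none.
- move=> p; apply/funext => i; rewrite /b.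
  case ti: (t i) => [c|c].
    by rewrite /a -[lshift s c]/(unsplit (inl c)) unsplitK -ti th.
  by rewrite za laurent_map_mul // AB laurent_map1 -ti th.
- move=> y; apply/funext => j; rewrite /a bh laurent_map_mul // BA laurent_map1.
  rewrite -[j in RHS]splitK; case: (fintype.split j) => c /=.
    by rewrite /b ht.
  by rewrite /z liftK.
- move=> j; rewrite /a; case: (fintype.split j) => c; first exact: regular_coord.
  by apply: regular_prod => i; apply: regular_exprz => //; exact: regular_coord.
- move=> i; rewrite /b; case: (t i) => c; first exact: regular_coord.
  apply: regular_prod => c'; apply: regular_exprz => //.
  rewrite /z; case: (unlift ord0 c') => [c''|]; first exact: regular_coord.
  exact: regular_cst.
Qed.

End TorusIsomorphism.

(** * Torsion in the quotient binoid for g = 0 *)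

Lemma quot_piMn (M : binoidType) (a b x : M) m :
  quot_pi a b x *+ m = quot_pi a b (x *+ m).
Proof.
elim: m => [|m IH] //; rewrite !mulrS IH; exact: quot_add_pi.
Qed.

Lemma free_ofMn n (a : {ffun 'I_n -> nat}) m : free_of a *+ m = free_of (a *+ m).
Proof. by elim: m => // m IH; rewrite !mulrS IH. Qed.

Lemma free_inftyMn n m : (0 < m)%N -> (None : free_binoid n) *+ m = None.
Proof. by case: m => // m _; rewrite mulrS. Qed.

Section UnitCongruence.
Variables (n : nat) (f : {ffun 'I_n -> nat}).
Local Notation cong := (gen_cong (free_of f) (free_of 0)).

(** By induction on the congruence: transitivity adds up the multiples of [f], and infinity stays
    alone in its class. Multiples on both sides avoid subtracting exponents. *)
Lemma gen_cong_unit_inv x y : cong x y ->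
  match x, y with
  | Some a, Some b => exists k l, a + f *+ k = b + f *+ l
  | None, None => True
  | _, _ => False
  end.
Proof.
elim=> {x y}.
- by exists 0%N, 1%N; rewrite mulr0n mulr1n addr0 add0r.
- by case=> // a; exists 0%N, 0%N.
- by move=> [a|] [b|] // _ [k [l E]]; exists l, k.
- move=> [a|] [b|] [c|] // _ [k [l E]] _ [k' [l' E']].
  exists (k + k')%N, (l' + l)%N.
  by rewrite !mulrnDr !addrA E -E' addrAC.
- move=> [a|] [b|] [c|] // _ [k [l E]]; exists k, l.
  by rewrite addrAC E addrAC.
Qed.

Lemma gen_cong_unit_mul (a : {ffun 'I_n -> nat}) k :
  cong (free_of (a + f *+ k)) (free_of a).
Proof.
elim: k => [|k IH]; first by rewrite mulr0n addr0; exact: gen_cong_refl.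
apply: gen_cong_trans IH.
have /(gen_cong_add (free_of (a + f *+ k))) := gen_cong_rel (free_of f) (free_of 0).
rewrite add0r; congr (gen_cong _ _ _ _).
by rewrite mulrS addrCA.
Qed.

(** The hypothesis says that Z f is saturated in Z^n. If ma and mb are congruent, then m(a - b) is a
    multiple of f, hence so is a - b. *)
Lemma torsion_free_of_root_closed :
    (forall (m : nat) (v : 'I_n -> int) (j : int), (0 < m)%N ->
       (forall i, m%:Z * v i = j * (f i)%:Z) ->
       exists c : int, forall i, v i = c * (f i)%:Z) ->
  torsion_free (binomial_binoid f 0).
Proof.
move=> root m; elim/quot_ind=> x; elim/quot_ind=> y m_gt0.
rewrite !quot_piMn => /quot_piP; case: x y => [a|] [b|].
- rewrite -![Some _]/(free_of _) !free_ofMn => /gen_cong_unit_inv[k [l E]].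
  have [|c cE] := root m (fun i => (a i)%:Z - (b i)%:Z) (l%:Z - k%:Z) m_gt0.
    move=> i; have := congr1 (fun z : {ffun 'I_n -> nat} => (z i)%:Z) E.
    rewrite !(exponentDE, exponentMnE); lia.
  apply/quot_piP; case: c cE => c cE.
    have -> : a = b + f *+ c.
      by apply/ffunP => i; have := cE i; rewrite /= !(exponentDE, exponentMnE); lia.
    exact: gen_cong_unit_mul.
  (* [Negz c] stands for -(c + 1), hence the shift by [c.+1]. *)
  have -> : b = a + f *+ c.+1.
    by apply/ffunP => i; have := cE i; rewrite /= !(exponentDE, exponentMnE); lia.
  by apply: gen_cong_sym; exact: gen_cong_unit_mul.
- by rewrite free_inftyMn // -[Some _]/(free_of _) free_ofMn => /gen_cong_unit_inv.
- by rewrite free_inftyMn // -[Some _]/(free_of _) free_ofMn => /gen_cong_unit_inv.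
- by [].
Qed.

End UnitCongruence.

(** Pairing m v = j f with [u] gives j = m (u.v); cancelling m leaves v = (u.v) f. *)
Lemma torsion_free_of_bezout n (f : {ffun 'I_n -> nat}) (u : 'I_n -> int) :
  \sum_i u i * (f i)%:Z = 1 -> torsion_free (binomial_binoid f 0).
Proof.
move=> uf1; apply: torsion_free_of_root_closed => m v j m_gt0 vE.
have jE : j = m%:Z * \sum_i u i * v i.
  rewrite mulr_sumr -[j]mulr1 -uf1 mulr_sumr; apply: eq_bigr => i _.
  by rewrite mulrCA -vE mulrCA.
exists (\sum_i u i * v i) => i.
have m0 : m%:Z != 0 by rewrite -lt0n.
by apply: (mulfI m0); rewrite vE jE mulrA.
Qed.

Lemma torsion_free_free n : torsion_free (binomial_binoid (0 : {ffun 'I_n -> nat}) 0).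
Proof.
apply: torsion_free_of_root_closed => m v j m_gt0 vE; exists 0 => i.
by have /eqP := vE i; rewrite ffunE !mulr0 mulf_eq0 => /orP[/eqP|/eqP]; lia.
Qed.

(** * Exponents divisible by some d > 1 *)

Section NontrivialRoot.
Variables (K : closedFieldType) (charK : [pchar K] =i pred0).
Variables (n d : nat) (f : {ffun 'I_n -> nat}).
Hypotheses (d_gt1 : (1 < d)%N) (f_neq0 : f <> 0).

Lemma natr_neq0 : d%:R != 0 :> K.
Proof. by move: charK => /pcharf0P->; rewrite -lt0n ltnW. Qed.

(** A root z of 1 + X + ... + X^(d-1) satisfies z^d = 1, and z is not 1 because d is nonzero in K.
    Putting an f_i-th root of z at one index of the support and 1 elsewhere gives X^f = z. *)
Lemma monomial_nontrivial_root :
  exists2 x : affine K n, monomial x f != 1 & monomial x f ^+ d = 1.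
Proof.
have [z zP] : exists z : K, root (\sum_(k < d) 'X^k) z.
  apply/closed_rootP; case: d d_gt1 => [//|[//|d' _]].
  have -> : \sum_(k < d'.+2) 'X^k = \poly_(k < d'.+2) 1 :> {poly K}.
    by rewrite poly_def; apply: eq_bigr => k _; rewrite scale1r.
  by rewrite size_poly_eq ?oner_neq0.
have zE : \sum_(k < d) z ^+ k = 0.
  move/rootP: zP; rewrite horner_sum => zP; rewrite -[RHS]zP.
  by apply: eq_bigr => k _; rewrite hornerXn.
have z1 : z != 1.
  apply: contra_neq natr_neq0 => z1; rewrite -[RHS]zE z1.
  under eq_bigr do rewrite expr1n.
  by rewrite sumr_const card_ord.
have zd : z ^+ d = 1 by apply/eqP; rewrite -subr_eq0 subrX1 zE mulr0.
have [i fi] : exists i, f i != 0%N.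
  apply: contrapT => /forallNP fN; apply: f_neq0; apply/ffunP => i.
  by rewrite ffunE; apply/eqP/negPn/negP; exact: fN.
have [y yP] : exists y : K, root ('X^(f i) - z%:P) y.
  by apply/closed_rootP; rewrite size_XnsubC ?lt0n // eqSS.
have yE : y ^+ f i = z.
  by move/rootP: yP; rewrite !hornerE => /eqP; rewrite subr_eq0 => /eqP.
exists (fun j => if j == i then y else 1); rewrite /monomial /= (bigD1 i) //=;
  rewrite eqxx yE big1 ?mulr1 // => j /negbTE->; exact: expr1n.
Qed.

Lemma not_connected_multiple : ~ connected_space (binomial_kspec K (f *+ d) 0).
Proof.
have [x x1 xd] := monomial_nontrivial_root.
have [|p pE] := @kcoord_onto K n (f *+ d) 0 x.
  by rewrite monomialMn monomial0.
have [|q qE] := @kcoord_onto K n (f *+ d) 0 (fun=> 1).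
  by rewrite !monomial_one.
(* The factors come from the geometric sum; where X^f = 1 the second one equals d, which is
   nonzero. *)
apply: (@not_connected_regular K n (binomial_kspec K (f *+ d) 0) (@kcoord K n _ _)
  (fun z => monomial (kcoord z) f - 1)
  (fun z => \sum_(k < d) monomial (kcoord z) f ^+ k) p q).
- exact: kcoord_embedded.
- by apply: regular_add; [exact: regular_monomial|exact: regular_cst].
- by apply: regular_sum => k; apply: regular_exp; exact: regular_monomial.
- by move=> z; rewrite -subrX1 -monomialMn kcoordP monomial0 subrr.
- move=> z /eqP; rewrite subr_eq0 => /eqP->; under eq_bigr do rewrite expr1n.
  by rewrite sumr_const card_ord natr_neq0.
- by rewrite pE subr_eq0.
- rewrite qE monomial_one; under eq_bigr do rewrite expr1n.
  by rewrite sumr_const card_ord natr_neq0.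
Qed.

(** The class of [f] becomes 0 after multiplication by d, but it is not 0: a point of the spectrum
    with X^f different from 1 separates them. *)
Lemma not_torsion_free_multiple : ~ torsion_free (binomial_binoid (f *+ d) 0).
Proof.
move=> tf; have [x /eqP x1 xd] := monomial_nontrivial_root; apply: x1.
have /quot_piP fP : quot_pi (free_of (f *+ d)) (free_of 0) (free_of f) =
    quot_pi (free_of (f *+ d)) (free_of 0) (free_of 0).
  apply: (tf d); first exact: ltnW.
  rewrite !quot_piMn !free_ofMn mul0rn; apply/quot_piP; exact: gen_cong_rel.
rewrite -[RHS](monomial0 x); apply: free_eval_cong fP.
by rewrite -!/(monomial _ _) monomialMn monomial0.
Qed.

End NontrivialRoot.

(** * The case g = 0 and the full statement *)

Lemma unit_binomial_kspec (K : closedFieldType) (charK : [pchar K] =i pred0)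
    (n : nat) (n_gt0 : (1 <= n)%N) (f : {ffun 'I_n -> nat}) :
  (connected_space (binomial_kspec K f 0) <->
     torsion_free (binomial_binoid f 0)) /\
  (connected_space (binomial_kspec K f 0) ->
     exists r s : nat,
       isomorphic_varieties
         (@kcoord K n f 0 : binomial_kspec K f 0 -> affine K n)
         (fun y : affine_torus K r s => set_val y)).
Proof.
have connT r s : isomorphic_varieties
    (@kcoord K n f 0 : binomial_kspec K f 0 -> affine K n)
    (fun y : affine_torus K r s => set_val y) ->
    connected_space (binomial_kspec K f 0).
  by apply: isomorphic_torus_connected; exact: binomial_kspec_nonempty.
(* In the first two cases the spectrum is connected and the binoid torsion-free; in the third both
   fail. *)
have [f0|[u uf1]|[d [f1 [d_gt1 f10 fE]]]] := exponent_trichotomy f n_gt0.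
- have iso : isomorphic_varieties
      (@kcoord K n f 0 : binomial_kspec K f 0 -> affine K n)
      (fun y : affine_torus K n 0 => set_val y).
    by rewrite f0; exact: affine_isomorphism.
  split; last by exists n, 0%N.
  by split=> _; [rewrite f0; exact: torsion_free_free|exact: connT iso].
- have [r [s iso]] := torus_isomorphism K uf1.
  split; last by exists r, s.
  by split=> _; [exact: torsion_free_of_bezout uf1|exact: connT iso].
- have nc := not_connected_multiple charK d_gt1 f10.
  have nt := not_torsion_free_multiple charK d_gt1 f10.
  by rewrite fE; split=> [|/nc//]; split=> [/nc|/nt].
Qed.

Theorem proposition4p5p5 (K : closedFieldType) (charK : [pchar K] =i pred0)
    (n : nat) (n_gt0 : (1 <= n)%N) (f g : {ffun 'I_n -> nat}) :
  [/\ g = 0 ->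
        (connected_space (binomial_kspec K f g) <->
           torsion_free (binomial_binoid f g)) /\
        (connected_space (binomial_kspec K f g) ->
           exists r s : nat,
             isomorphic_varieties
               (@kcoord K n f g : binomial_kspec K f g -> affine K n)
               (fun y : affine_torus K r s => set_val y)),
      g <> 0 ->
        forall f' : {ffun 'I_n -> nat}, f = f' + g ->
          (supp g \subset supp f' ->
             disconnected_space (binomial_kspec K f g)) /\
          (~~ (supp g \subset supp f') ->
             connected_space (binomial_kspec K f g))
    & forall f' g' h : {ffun 'I_n -> nat}, f = f' + h -> g = g' + h ->
        supp f' <> finset.set0 -> supp g' <> finset.set0 ->
        supp f' :&: supp g' = finset.set0 ->
        connected_space (binomial_kspec K f g)].
Proof.
split.
- by move=> ->; exact: unit_binomial_kspec.
- move=> g0 f' ->; split=> [gf|]; last exact: connected_of_not_supp_subset.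
  split; first exact: binomial_kspec_nonempty.
  move=> cT; apply: (@disconnected_of_supp_subset K n f' g g0 gf).
  by split=> //; exact: binomial_kspec_nonempty.
- by move=> f' g' h -> ->; exact: connected_of_disjoint_supp.
Qed.
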